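(* Let $\ell\in\mathbb{N}$ and let $s>1$ be real. For $M\geq 1$ let \[ P_{\ell}(s;M):=\sum_{k\in \Omega(\ell):\, k\geq M}\frac{1}{k^{s}}, \] where $\Omega(\ell)$ is the set of positive integers with at most $\ell$ (not necessarily distinct) prime factors. Then there exist constants $C_1,C_2>0$ and $M_0$ such that for every $M\geq M_0$, \[ C_1\,\frac{(\log\log M)^{\ell-1}}{M^{s-1}\log M}\;\leq\; P_{\ell}(s;M)\;\leq\; C_2\,\frac{(\log\log M)^{\ell-1}}{M^{s-1}\log M}. \]
   Context: $\Omega(\ell)$ denotes the set of $\ell$-almost primes: positive integers with at most $\ell$ prime factors counted with multiplicity (e.g. $\Omega(1)$ is the set of primes, and $4,6\in\Omega(2)$). *)

(* Defs.v *)
From mathcomp Require Import ssreflect ssrbool ssrnat seq bigop prime.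
From Stdlib Require Import Reals.
From Coquelicot Require Import Coquelicot.

Definition bigomega (n : nat) : nat :=
  \sum_(p <- primes n) logn p n.

Definition almost_prime (l k : nat) : bool :=
  leq 1 k && leq (bigomega k) l.

Open Scope R_scope.

Definition P_term (l : nat) (s M : R) (k : nat) : R :=
  if almost_prime l k && Rle_dec M (INR k) then / Rpower (INR k) s else 0.

Definition P_sum (l : nat) (s M : R) : R := Series (P_term l s M).

(* Main.v *)
(** Weighting by the logarithm linearises the problem: if [k] has at most [l] prime factors then
    [ln k <= l * \sum_(p | k) ln p], so writing [k = p m] with [m] having at most [l - 1] prime
    factors,
<<
      ln M * P_l(s; M) <= l * \sum_m m^(-s) * \sum_(p >= M / m) p^(-s) ln p.
>>
    Chebyshev's bound [\sum_(p < x) ln p = O(x)] makes the inner sum [O((M / m)^(1 - s))] for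
    [m <= M], so the right-hand side is [O(M^(1 - s) * \sum_(m <= M) 1 / m)] up to the terms
    [m > M], which contribute [O(M^(1 - s))].  In the other direction every [k] is of the form
    [p m] in at most [l] ways, so [l * P_l(s; M)] dominates the sum of [(p m)^(-s)] over
    [m <= sqrt M] and [p >= M / m], and the lower bound
    [\sum_(p >= y) p^(-s) >= c * y^(1 - s) / ln y] again leaves [\sum_m 1 / m].  The sum of [1 / m]
    over [m <= x] with at most [j] prime factors has order [(ln ln x)^j]: the same double counting
    of [m = p m'] reduces this to [\sum_(p <= x) 1 / p], which has order [ln ln x] by partial
    summation from Chebyshev's and Mertens' bounds. *)

From HB Require Import structures.
From mathcomp Require ssreflect ssrfun ssrbool eqtype ssrnat seq div bigop prime binomial zify.
Require Import Defs.
From Stdlib Require Import Reals Lra Lia.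
From Coquelicot Require Import Coquelicot.
Open Scope R_scope.

(* The module confines the [ssrnat] notations, which would change the reading of [(1 <= l)%nat]
   in the theorem. *)
Module AlmostPrimes.
Import ssreflect ssrfun ssrbool eqtype ssrnat seq div bigop prime binomial zify.

Set Implicit Arguments.
Unset Strict Implicit.
Unset Printing Implicit Defensive.

(** * Finite real sums *)

(** These instances make the generic [bigop] lemmas on splitting, exchange and distributivity apply
    to finite sums of reals. *)
HB.instance Definition _ :=
  Monoid.isComLaw.Build R 0 Rplus (fun x y z => esym (Rplus_assoc x y z)) Rplus_comm Rplus_0_l.
HB.instance Definition _ := Monoid.isMulLaw.Build R 0 Rmult Rmult_0_l Rmult_0_r.
HB.instance Definition _ := Monoid.isAddLaw.Build R Rmult Rplus
  (fun x y z => Rmult_plus_distr_r x y z) Rmult_plus_distr_l.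

Notation "\sum_ ( m <= i < n ) F" := (\big[Rplus/0]_(m <= i < n) F) : R_scope.
Notation "\sum_ ( m <= i < n | P ) F" := (\big[Rplus/0]_(m <= i < n | P) F) : R_scope.
Notation "\sum_ ( i <- r | P ) F" := (\big[Rplus/0]_(i <- r | P) F) : R_scope.
Notation "\sum_ ( i <- r ) F" := (\big[Rplus/0]_(i <- r) F) : R_scope.

Lemma INR_add m n : INR (m + n)%N = INR m + INR n.
Proof. exact: plus_INR. Qed.
Lemma INR_mul m n : INR (m * n)%N = INR m * INR n.
Proof. exact: mult_INR. Qed.
Lemma INR_leq m n : (m <= n)%N -> INR m <= INR n.
Proof. by move=> h; apply: le_INR; lia. Qed.
Lemma INR_ltn m n : (m < n)%N -> INR m < INR n.
Proof. by move=> h; apply: lt_INR; lia. Qed.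
Lemma leq_INR m n : INR m <= INR n -> (m <= n)%N.
Proof. by move=> h; apply/leP; exact: INR_le. Qed.
Lemma INR_gt0 n : (0 < n)%N -> 0 < INR n.
Proof. exact: (@INR_ltn 0). Qed.
Lemma INR_exp m n : INR (m ^ n)%N = INR m ^ n.
Proof. by elim: n => // n IH; rewrite expnS INR_mul IH. Qed.

Lemma rsum_ge0 (I : Type) (r : seq I) (P : pred I) (F : I -> R) :
  (forall i, P i -> 0 <= F i) -> 0 <= \sum_(i <- r | P i) F i.
Proof. by move=> h; apply: (big_ind (Rle 0)) => // [|x y]; lra. Qed.

Lemma rsum_le (I : Type) (r : seq I) (P : pred I) (F G : I -> R) :
  (forall i, P i -> F i <= G i) -> \sum_(i <- r | P i) F i <= \sum_(i <- r | P i) G i.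
Proof. by move=> h; apply: (big_ind2 Rle) => // [|x y z t]; lra. Qed.

Lemma rsum_le_nat m n (P : pred nat) (F G : nat -> R) :
  (forall i, (m <= i < n)%N -> P i -> F i <= G i) ->
  \sum_(m <= i < n | P i) F i <= \sum_(m <= i < n | P i) G i.
Proof.
move=> h; rewrite big_nat_cond [X in _ <= X]big_nat_cond.
by apply: rsum_le => i /andP[h1 h2]; apply: h.
Qed.

Lemma rsum_ge0_nat m n (P : pred nat) (F : nat -> R) :
  (forall i, (m <= i < n)%N -> P i -> 0 <= F i) -> 0 <= \sum_(m <= i < n | P i) F i.
Proof.
by move=> h; rewrite big_nat_cond; apply: rsum_ge0 => i /andP[h1 h2]; apply: h.
Qed.

Lemma rsum_subpred m n (P Q : pred nat) (F : nat -> R) :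
  (forall i, (m <= i < n)%N -> P i -> Q i) ->
  (forall i, (m <= i < n)%N -> Q i -> 0 <= F i) ->
  \sum_(m <= i < n | P i) F i <= \sum_(m <= i < n | Q i) F i.
Proof.
move=> hPQ hF; rewrite big_mkcond [X in _ <= X]big_mkcond.
apply: rsum_le_nat => i hi _.
have := hPQ i hi; have := hF i hi; case: (P i); case: (Q i) => //= h1 h2; try lra.
- by have := h2 erefl.
- exact: h1.
Qed.

Lemma rsum_widen m n n' (P : pred nat) (F : nat -> R) :
  (n <= n')%N -> (forall i, (m <= i < n')%N -> P i -> 0 <= F i) ->
  \sum_(m <= i < n | P i) F i <= \sum_(m <= i < n' | P i) F i.
Proof.
move=> hn hF.
have [hm|hm] := leqP m n; last first.
  by rewrite [X in X <= _]big_geq ?(ltnW hm) //; apply: rsum_ge0_nat.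
rewrite [X in _ <= X](big_cat_nat hm hn) /=.
have := @rsum_ge0_nat n n' P F; have : forall i, (n <= i < n')%N -> P i -> 0 <= F i.
  by move=> i hi; apply: hF; lia.
by move=> h /(_ h); lra.
Qed.

Lemma telescope_rsum (f : nat -> R) m n : (m <= n)%N ->
  \sum_(m <= k < n) (f k.+1 - f k) = f n - f m.
Proof.
elim: n => [|n IH] h; first by rewrite big_geq // (_ : m = 0%N); [lra | lia].
move: h; rewrite leq_eqVlt => /orP[/eqP <-|h]; first by rewrite big_geq //; lra.
by rewrite big_nat_recr //= IH //; lra.
Qed.

(** Summation by parts with the boundary term [E N * f N >= 0] dropped. Later [E] is the gap in a
    Chebyshev or Mertens bound, so only its sign has to be known. *)
Lemma abel_ge (E f : nat -> R) n N : (n <= N)%N ->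
  (forall k, (n <= k)%N -> 0 <= E k) ->
  (forall k, (n <= k)%N -> 0 <= f k) ->
  (forall k, (n <= k)%N -> f k.+1 <= f k) ->
  - (E n * f n) <= \sum_(n <= k < N) (E k.+1 - E k) * f k.
Proof.
move=> hnN hE hf hd.
suff : E N * f N - E n * f n <= \sum_(n <= k < N) (E k.+1 - E k) * f k.
  by have := Rmult_le_pos _ _ (hE N hnN) (hf N hnN); lra.
elim: N hnN => [|N IH] h; first by rewrite big_geq // (_ : n = 0%N); [lra | lia].
move: h; rewrite leq_eqVlt => /orP[/eqP <-|h]; first by rewrite big_geq //; lra.
rewrite big_nat_recr //=; have := IH h.
have := Rmult_le_compat_l _ _ _ (hE N.+1 (leqW h)) (hd N h).
lra.
Qed.

Lemma ln_le_sub1 x : 0 < x -> ln x <= x - 1.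
Proof.
move=> hx; rewrite -[X in _ <= X]ln_exp; apply: ln_le => //.
have := exp_ineq1_le (x - 1); lra.
Qed.

Lemma ln_ge0 x : 1 <= x -> 0 <= ln x.
Proof. by move=> h; rewrite -ln_1; apply: ln_le; lra. Qed.

Lemma ln_gt0 x : 1 < x -> 0 < ln x.
Proof. by move=> h; rewrite -ln_1; apply: ln_increasing; lra. Qed.

(** From [ln t <= t - 1] at [t = x / y]. The order of [x] and [y] is free, so the lemma bounds
    increments of [ln] from both sides. *)
Lemma ln_sub_ge x y : 0 < x -> 0 < y -> (y - x) / y <= ln y - ln x.
Proof.
move=> hx hy.
have h := ln_le_sub1 (Rdiv_lt_0_compat _ _ hx hy).
have -> : (y - x) / y = 1 - x / y by field; lra.
by rewrite ln_div // in h; lra.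
Qed.

(** A range that does not depend on [n] is what allows sums over [n] and over its prime divisors to
    be exchanged. *)
Lemma big_primesE (T : Type) (idx : T) (op : Monoid.com_law idx) n K (F : nat -> T) :
  (0 < n)%N -> (forall p, prime p -> (p %| n)%N -> (p < K)%N) ->
  \big[op/idx]_(p <- primes n) F p = \big[op/idx]_(1 <= p < K | prime p && (p %| n)%N) F p.
Proof.
move=> hn hK; rewrite -[RHS]big_filter; apply: perm_big; apply: uniq_perm.
- exact: primes_uniq.
- exact/filter_uniq/iota_uniq.
move=> p; rewrite mem_filter mem_index_iota mem_primes hn /=.
case hp: (prime p) => //=; case hd: (p %| n)%N => //=.
by rewrite prime_gt0 //= hK.
Qed.

Lemma rsum_primesE n K (F : nat -> R) : (0 < n)%N ->
  (forall p, prime p -> (p %| n)%N -> (p < K)%N) ->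
  \sum_(p <- primes n) F p = \sum_(1 <= p < K | prime p && (p %| n)%N) F p.
Proof. exact: big_primesE. Qed.

Lemma ln_primes n : (0 < n)%N -> ln (INR n) = \sum_(p <- primes n) INR (logn p n) * ln (INR p).
Proof.
move=> hn; rewrite {1}(prod_prime_decomp hn) prime_decompE big_map /=.
have : {in primes n, forall p, (0 < p)%N}.
  by move=> p; rewrite mem_primes => /andP[/prime_gt0].
elim: (primes n) => [|p r IH] h; first by rewrite !big_nil /= ln_1.
rewrite !big_cons INR_mul ln_mult.
- rewrite IH; last by move=> q hq; apply: h; rewrite in_cons hq orbT.
  by rewrite INR_exp ln_pow //; apply/INR_gt0/h/mem_head.
- by apply/INR_gt0; rewrite expn_gt0 h // mem_head.
- apply/INR_gt0; rewrite big_seq; apply: prodn_cond_gt0 => q hq.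
  by rewrite expn_gt0 h // in_cons hq orbT.
Qed.

(** * Chebyshev and Mertens bounds *)

(** Chebyshev's function with a strict bound: [theta k.+1 - theta k] is then the contribution of [k]
    itself, the shape that [abel_ge] expects. *)
Definition theta K := \sum_(1 <= p < K | prime p) ln (INR p).

Lemma prime_dvd_fact p n : prime p -> (p %| n`!)%N = (p <= n)%N.
Proof.
move=> hp; apply/idP/idP => [|h]; last by apply: dvdn_fact; rewrite prime_gt0.
elim: n => [|n IH]; first by rewrite fact0 dvdn1 => /eqP h; rewrite h in hp.
rewrite factS Euclid_dvdM // => /orP[/dvdn_leq h|/IH]; first exact: h.
exact: leqW.
Qed.

Lemma bin_le_exp2 n k : ('C(n, k) <= 2 ^ n)%N.
Proof.
elim: n k => [|n IH] [|k]; rewrite ?bin0 ?bin0n ?expn_gt0 //.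
by rewrite binS expnS mul2n -addnn leq_add.
Qed.

Lemma INR_prime_ge2 p : prime p -> 2 <= INR p.
Proof. by move=> /prime_gt1 h; rewrite -[2]/(INR 2); apply: INR_leq. Qed.

Lemma ln_prime_gt0 p : prime p -> 0 < ln (INR p).
Proof. by move=> /INR_prime_ge2 h; apply: ln_gt0; lra. Qed.

(** Every prime in [(n, 2n]] divides the central binomial coefficient, which is at most [2^(2n)]. *)
Lemma theta_double n : theta (n + n).+1 <= theta n.+1 + INR (n + n)%N * ln 2.
Proof.
rewrite /theta [X in X <= _](big_cat_nat (n := n.+1)) /=; [|lia|lia].
apply: Rplus_le_compat_l.
have hC : (0 < 'C(n + n, n))%N by rewrite bin_gt0; lia.
have hf := bin_fact (leq_addr n n).
apply: (Rle_trans _ (ln (INR 'C(n + n, n)))); last first.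
  rewrite -ln_pow; last lra.
  apply: ln_le; first exact: INR_gt0.
  by rewrite -[2]/(INR 2) -INR_exp; apply/INR_leq/bin_le_exp2.
rewrite ln_primes // (@rsum_primesE _ (n + n).+1) //; last first.
  by move=> p hp hd; rewrite ltnS -prime_dvd_fact // -hf dvdn_mulr.
rewrite [X in _ <= X](big_cat_nat (n := n.+1)) /=; [|lia|lia].
set a := (X in _ <= X + _).
have ha : 0 <= a.
  apply: rsum_ge0 => p /andP[hp _].
  by apply: Rmult_le_pos; [exact: pos_INR | exact/Rlt_le/ln_prime_gt0].
suff h : \sum_(n.+1 <= i < (n + n).+1 | prime i) ln (INR i) <=
   \sum_(n.+1 <= i < (n + n).+1 | prime i && (i %| 'C(n + n, n))%N)
     INR (logn i 'C(n + n, n)) * ln (INR i) by lra.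
(* Such a [p] divides [(2n)!], which is the binomial coefficient times [n!^2], but does not divide
   [n!]. *)
have hdvd p : (n < p < (n + n).+1)%N -> prime p -> (p %| 'C(n + n, n))%N.
  move=> /andP[h1 h2] hp.
  have : (p %| (n + n)`!)%N by rewrite prime_dvd_fact.
  rewrite -hf !Euclid_dvdM // !prime_dvd_fact // => /orP[//|]; lia.
apply: (@Rle_trans _ (\sum_(n.+1 <= i < (n + n).+1 | prime i && (i %| 'C(n + n, n))%N) ln (INR i))).
  apply: rsum_subpred => i hi.
    by move=> hp; rewrite hp hdvd.
  by move=> /andP[hp _]; exact/Rlt_le/ln_prime_gt0.
apply: rsum_le => p /andP[hp hd].
have h1 : INR 1 <= INR (logn p 'C(n + n, n)).
  by apply: INR_leq; rewrite logn_gt0 mem_primes hp hC.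
have := Rmult_le_compat_r _ _ _ (Rlt_le _ _ (ln_prime_gt0 hp)) h1.
by rewrite /= ; lra.
Qed.

Lemma theta_mono m n : (m <= n)%N -> theta m <= theta n.
Proof.
move=> h; apply: rsum_widen => // p _ hp; exact/Rlt_le/ln_prime_gt0.
Qed.

Lemma ln2_bounds : 0 < ln 2 < 1.
Proof.
split; first by apply: ln_gt0; lra.
have [h1 h2] := (exp_ineq1 1, ln_exp 1).
rewrite -h2; apply: ln_increasing; first lra.
by have := h1 ltac:(lra); lra.
Qed.

Lemma theta_ge0 n : 0 <= theta n.
Proof. by apply: rsum_ge0 => p hp; exact/Rlt_le/ln_prime_gt0. Qed.

(** Iterated doubling gives [2 * 2^k * ln 2] at powers of two; rounding [K] up to the next power
    costs another factor 2, and [ln 2 < 1]. *)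
Lemma theta_le K : theta K <= 4 * INR K.
Proof.
have hl := ln2_bounds.
have hpow k : theta (2 ^ k).+1 <= 2 * INR (2 ^ k) * ln 2.
  elim: k => [|k IH].
    rewrite /theta expn0 big_ltn_cond //= big_geq //=; lra.
  rewrite expnS mul2n -addnn; have := theta_double (2 ^ k).
  by rewrite INR_add; lra.
have [->|hK] := posnP K; first by rewrite /theta big_geq //=; lra.
have h1 := trunc_logP (isT : (1 < 2)%N) hK.
have h2 := trunc_log_ltn K (isT : (1 < 2)%N).
have h3 := hpow (trunc_log 2 K).+1.
have h4 := @theta_mono K (2 ^ (trunc_log 2 K).+1).+1 ltac:(lia).
rewrite expnS INR_mul /= in h3.
have := INR_leq h1; have := pos_INR (2 ^ trunc_log 2 K).
set a := INR (2 ^ _) in h3 *; rewrite expnS in h4; nra.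
Qed.

Definition lnp_over K := \sum_(1 <= p < K | prime p) (ln (INR p) / INR p).

(** Legendre's formula without the floors is a geometric series with sum [n / (p - 1)]. *)
Lemma logn_fact_le p n : prime p -> INR (logn p n`!) * (INR p - 1) <= INR n.
Proof.
move=> hp; have h2 := INR_prime_ge2 hp; rewrite logn_fact //.
(* The closed form of the truncated geometric series is what makes the induction go through. *)
suff H m : INR (\sum_(1 <= k < m.+1) n %/ p ^ k)%N * (INR p - 1) <= INR n * (1 - / INR p ^ m).
  apply: (Rle_trans _ _ _ (H n)).
  have h : 0 < / INR p ^ n by apply/Rinv_0_lt_compat/pow_lt; lra.
  have := pos_INR n; nra.
elim: m => [|m IH]; first by rewrite big_geq //= Rinv_1; lra.
rewrite big_nat_recr //= INR_add Rmult_plus_distr_r.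
have h3 : 0 < INR p ^ m by apply/pow_lt; lra.
have h : INR (n %/ p ^ m.+1) * (INR p * INR p ^ m) <= INR n.
  have := INR_leq (leq_trunc_div n (p ^ m.+1)).
  by rewrite INR_mul INR_exp.
have h4 : INR (n %/ p ^ m.+1) <= INR n / (INR p * INR p ^ m).
  by apply/Rle_div_r => //; apply: Rmult_lt_0_compat; lra.
have h5 := Rmult_le_compat_r (INR p - 1) _ _ ltac:(lra) h4.
have e : INR n / (INR p * INR p ^ m) * (INR p - 1) = INR n * (/ INR p ^ m - / (INR p * INR p ^ m)).
  by field; split; lra.
lra.
Qed.

(** Only the first term [floor (n / p)] of Legendre's formula is kept. *)
Lemma logn_fact_ge p n : prime p -> INR n / INR p - 1 <= INR (logn p n`!).
Proof.
move=> hp; have h2 := INR_prime_ge2 hp; rewrite logn_fact //.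
case: n => [|n]; first by rewrite big_geq //= /Rdiv Rmult_0_l; lra.
rewrite big_ltn // expn1 INR_add.
have h := pos_INR (\sum_(2 <= i < n.+2) n.+1 %/ p ^ i)%N.
suff : INR n.+1 / INR p < INR (n.+1 %/ p) + 1 by lra.
apply/Rlt_div_l; first lra.
have := INR_ltn (ltn_ceil n.+1 (prime_gt0 hp)).
by rewrite INR_mul (S_INR (n.+1 %/ p)%N).
Qed.

Lemma ln_fact n : ln (INR n`!) = \sum_(1 <= p < n.+1 | prime p) INR (logn p n`!) * ln (INR p).
Proof.
rewrite ln_primes ?fact_gt0 // (@rsum_primesE _ n.+1) ?fact_gt0 //; last first.
  by move=> p hp; rewrite prime_dvd_fact.
rewrite big_nat_cond [RHS]big_nat_cond; apply: eq_bigl => p.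
case: (boolP (1 <= p < n.+1)%N) => //= hpn; case hp: (prime p) => //=.
by rewrite prime_dvd_fact //; lia.
Qed.

Lemma ln_fact_le n : (0 < n)%N -> ln (INR n`!) <= INR n * ln (INR n).
Proof.
move=> hn; rewrite -ln_pow; last exact: INR_gt0.
apply: ln_le; first by apply/INR_gt0/fact_gt0.
rewrite -INR_exp; apply/INR_leq.
have : forall m, (m <= n)%N -> (m`! <= n ^ m)%N.
  elim=> [|m IH] h //; rewrite factS expnS leq_mul // IH //; lia.
exact.
Qed.

(** Weak Stirling bound; the induction step amounts to [m * (ln (m + 1) - ln m) <= 1]. *)
Lemma ln_fact_ge n : (0 < n)%N -> INR n * ln (INR n) - INR n <= ln (INR n`!).
Proof.
elim: n => // -[|n] IH _; first by rewrite /= ln_1; lra.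
have := IH isT; set m := n.+1; rewrite factS INR_mul => h.
have hm : 0 < INR m by exact: INR_gt0.
have hS : INR m.+1 = INR m + 1 by rewrite S_INR.
rewrite ln_mult; [|by rewrite hS; lra|exact/INR_gt0/fact_gt0].
have := ln_sub_ge (x := INR m.+1) (y := INR m) ltac:(lra) ltac:(lra).
rewrite hS.
have -> : (INR m - (INR m + 1)) / INR m = - / INR m by field; lra.
move=> h2; have := Rmult_le_compat_l _ _ _ (Rlt_le _ _ hm) h2.
rewrite -Ropp_mult_distr_r Rinv_r; lra.
Qed.

(** The terms, taken over all integers [k >= 2], are dominated by the increments of
    [f k = - (ln k + 2) / k], which telescope to at most [- f 1 = 2]. The summand 2 in [f] absorbs
    the error [(x + 1) / x <= 2]. *)
Lemma sum_ln_over_sqr n :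
  \sum_(1 <= p < n.+1 | prime p) (ln (INR p) / (INR p * (INR p - 1))) <= 2.
Proof.
pose f k := - ((ln (INR k) + 2) / INR k).
case: n => [|n]; first by rewrite big_geq //; lra.
rewrite big_ltn_cond //=.
apply: (Rle_trans _ (\sum_(2 <= k < n.+2) (f k - f k.-1))).
  rewrite big_mkcond; apply: rsum_le_nat => -[|[|k]] // _ _.
  have hk : 1 <= INR k.+1 by apply: (@INR_leq 1).
  have hS : INR k.+2 = INR k.+1 + 1 by rewrite S_INR.
  have hl : 0 <= ln (INR k.+2) by apply: ln_ge0; lra.
  have h1 := ln_sub_ge (x := INR k.+2) (y := INR k.+1) ltac:(lra) ltac:(lra).
  have h0 : ln (INR k.+2) / (INR k.+2 * (INR k.+2 - 1)) <= f k.+2 - f k.+1.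
    rewrite /f hS.
    set x := INR k.+1 in hk hS hl h1 *; rewrite hS in hl h1.
    have e : - ((ln (x + 1) + 2) / (x + 1)) - - ((ln x + 2) / x) - ln (x + 1) / ((x + 1) * (x + 1 - 1))
      = ((x + 1) * (ln x - ln (x + 1)) + 2) / (x * (x + 1)).
      by field; lra.
    have e2 : (x - (x + 1)) / x = - / x by field; lra.
    have h3 : 0 <= ((x + 1) * (ln x - ln (x + 1)) + 2) / (x * (x + 1)).
      apply: Rmult_le_pos; last by apply/Rlt_le/Rinv_0_lt_compat; nra.
      have := Rmult_le_compat_l (x + 1) _ _ ltac:(lra) h1; rewrite e2.
      have -> : (x + 1) * - / x = - 1 - / x by field; lra.
      have : / x <= 1 by rewrite -Rinv_1; apply: Rinv_le_contravar; lra.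
      lra.
    lra.
  case: (prime k.+2) => //.
  apply: Rle_trans h0; apply: Rmult_le_pos => //.
  by apply/Rlt_le/Rinv_0_lt_compat; nra.
rewrite big_add1 /=.
rewrite (telescope_rsum f) // /f /= ln_1.
have h : 0 <= (ln (INR n.+1) + 2) / INR n.+1.
  have h1 : 1 <= INR n.+1 by apply: (@INR_leq 1).
  have h2 := ln_ge0 h1.
  by apply: Rmult_le_pos; [lra|apply/Rlt_le/Rinv_0_lt_compat; lra].
rewrite /= in h; lra.
Qed.

(** Compare Stirling's bound with the factorisation of [n!], whose exponents are at most
    [n / (p - 1) = n / p + n / (p (p - 1))]. The 3 is 1 from Stirling plus 2 from
    [sum_ln_over_sqr]. *)
Lemma mertens_ge n : (0 < n)%N -> ln (INR n) - 3 <= lnp_over n.+1.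
Proof.
move=> hn; have h1 := ln_fact_ge hn; rewrite ln_fact in h1.
have hp := INR_gt0 hn.
suff h : \sum_(1 <= p < n.+1 | prime p) INR (logn p n`!) * ln (INR p) <= INR n * (lnp_over n.+1 + 2) by nra.
have h2 := Rmult_le_compat_l _ _ _ (Rlt_le _ _ hp) (sum_ln_over_sqr n).
apply: (Rle_trans _ (INR n * (lnp_over n.+1 + \sum_(1 <= p < n.+1 | prime p) (ln (INR p) / (INR p * (INR p - 1)))))); last by lra.
rewrite /lnp_over -big_split big_distrr /=.
apply: rsum_le => p pp; have h3 := logn_fact_le n pp.
have h4 := ln_prime_gt0 pp; have h5 := INR_prime_ge2 pp.
have -> : INR n * (ln (INR p) / INR p + ln (INR p) / (INR p * (INR p - 1))) = (INR n / (INR p - 1)) * ln (INR p).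
  by field; lra.
apply: Rmult_le_compat_r; first lra.
by apply/Rle_div_r => //; lra.
Qed.

(** Here the exponents are at least [n / p - 1], and the loss is
    [theta n.+1 <= 4 (n + 1) <= 8 n]. *)
Lemma mertens_le n : (0 < n)%N -> lnp_over n.+1 <= ln (INR n) + 8.
Proof.
move=> hn; have h1 := ln_fact_le hn; rewrite ln_fact in h1.
have hp := INR_gt0 hn.
have h0 : 1 <= INR n by apply: (@INR_leq 1).
have h2 := theta_le n.+1; rewrite S_INR in h2.
suff h : INR n * lnp_over n.+1 - theta n.+1 <= \sum_(1 <= p < n.+1 | prime p) INR (logn p n`!) * ln (INR p) by nra.
have -> : INR n * lnp_over n.+1 - theta n.+1 = INR n * lnp_over n.+1 + (-1) * theta n.+1 by lra.
rewrite /lnp_over /theta !big_distrr -big_split /=.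
apply: rsum_le => p pp; have h3 := logn_fact_ge n pp.
have h4 := ln_prime_gt0 pp; have h5 := INR_prime_ge2 pp.
have -> : INR n * (ln (INR p) / INR p) + -1 * ln (INR p) = (INR n / INR p - 1) * ln (INR p).
  by field; lra.
by apply: Rmult_le_compat_r; lra.
Qed.

(** * Sums over primes *)

Lemma RleP x y : reflect (x <= y) (Rle_dec x y).
Proof. by case: Rle_dec => h; constructor. Qed.

(** This bound and the next replace the integral of [1 / (x ln x)] by telescoping sums of
    [ln ln]. *)
Lemma lnln_diff_ge x : 1 < x -> / ((x + 1) * ln (x + 1)) <= ln (ln (x + 1)) - ln (ln x).
Proof.
move=> hx; have h1 := ln_gt0 hx.
have h2 : 0 < ln (x + 1) by apply: ln_gt0; lra.
apply: Rle_trans (ln_sub_ge h1 h2).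
have h3 := @ln_sub_ge x (x + 1) ltac:(lra) ltac:(lra).
rewrite Rinv_mult; apply: Rmult_le_compat_r; first exact/Rlt_le/Rinv_0_lt_compat.
by apply: Rle_trans h3; right; field; lra.
Qed.

Lemma lnln_diff_le x : 1 < x -> ln (ln (x + 1)) - ln (ln x) <= / (x * ln x).
Proof.
move=> hx; have h1 := ln_gt0 hx.
have h2 : 0 < ln (x + 1) by apply: ln_gt0; lra.
have h := ln_sub_ge h2 h1.
have h3 := @ln_sub_ge (x + 1) x ltac:(lra) ltac:(lra).
have h4 := Rmult_le_compat_r (/ ln x) _ _ (Rlt_le _ _ (Rinv_0_lt_compat _ h1)) h3.
have e : (x - (x + 1)) / x * / ln x = - / (x * ln x) by field; lra.
rewrite /Rdiv in h e h4; lra.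
Qed.

Lemma rsum_prime_mkcond (g : nat -> R) K :
  \sum_(1 <= p < K | prime p) g p = \sum_(2 <= k < K) (if prime k then g k else 0).
Proof.
have [h|h] := leqP K 1; first by rewrite !big_geq //; lia.
by rewrite big_ltn_cond //= big_mkcond.
Qed.

Lemma rsum_prime_recr (g : nat -> R) k : (0 < k)%N ->
  \sum_(1 <= p < k.+1 | prime p) g p =
  \sum_(1 <= p < k | prime p) g p + (if prime k then g k else 0).
Proof. by move=> hk; rewrite big_mkcond big_nat_recr //= -big_mkcond. Qed.

Definition inv_primes K := \sum_(1 <= p < K | prime p) / INR p.

Lemma INR2 : INR 2 = 2.
Proof. by []. Qed.

Lemma INR_ge2 k : (2 <= k)%N -> 2 <= INR k.
Proof. by move=> h; rewrite -[2]/(INR 2); apply: INR_leq. Qed.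

Lemma inv_xlnx_decr k : (2 <= k)%N ->
  / (INR k.+1 * ln (INR k.+1)) <= / (INR k * ln (INR k)).
Proof.
move=> /INR_ge2 h; have h1 : 0 < ln (INR k) by apply: ln_gt0; lra.
rewrite S_INR; have h2 : ln (INR k) <= ln (INR k + 1) by apply: ln_le; lra.
apply: Rinv_le_contravar; first by apply: Rmult_lt_0_compat; lra.
by apply: Rmult_le_compat; lra.
Qed.

(** Partial summation of the Chebyshev gap [4 k - theta k] against [f k = 1 / (k ln k)], a weight
    that turns [ln p] into [1 / p]. In the constant, [12 f 2] is [8 f 2] from the boundary and
    [4 f 2] from the first term of the sum of [f]. *)
Lemma inv_primes_le : exists C, 0 < C /\
  forall K, (3 <= K)%N -> inv_primes K <= 4 * ln (ln (INR K)) + C.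
Proof.
have hl := ln2_bounds.
pose f k := / (INR k * ln (INR k)).
have hf k : (2 <= k)%N -> 0 <= f k.
  move=> /INR_ge2 h; apply/Rlt_le/Rinv_0_lt_compat/Rmult_lt_0_compat; first lra.
  by apply: ln_gt0; lra.
have hf2 := hf 2%N isT.
exists (12 * f 2%N + 4 * Rabs (ln (ln 2)) + 1); split.
  by have := Rabs_pos (ln (ln 2)); lra.
move=> K hK.
have := @abel_ge (fun k => 4 * INR k - theta k) f 2 K ltac:(lia) _ hf inv_xlnx_decr.
have hE k : (2 <= k)%N -> 0 <= 4 * INR k - theta k by have := theta_le k; lra.
move=> /(_ hE) {hE}.
rewrite [theta 2]rsum_prime_mkcond big_geq // INR2.
have -> : \sum_(2 <= k < K) (4 * INR k.+1 - theta k.+1 - (4 * INR k - theta k)) * f k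
  = 4 * \sum_(2 <= k < K) f k - inv_primes K.
  rewrite [inv_primes _]rsum_prime_mkcond.
  have -> (a b : R) : 4 * a - b = 4 * a + (-1) * b by ring.
  rewrite !big_distrr -big_split; apply: eq_big_nat => k /andP[hk _]; rewrite ?S_INR /=.
  have h2 := INR_ge2 hk; have h3 : 0 < ln (INR k) by apply: ln_gt0; lra.
  rewrite [theta k.+1]rsum_prime_recr; last lia.
  rewrite -/(theta k) /f; case: (prime k); field; lra.
move=> h.
have hs : \sum_(2 <= k < K) f k <= f 2%N + (ln (ln (INR K)) - ln (ln 2)).
  rewrite big_ltn; last lia.
  apply: Rplus_le_compat_l.
  have := @telescope_rsum (fun k => ln (ln (INR k))) 2 K.-1 ltac:(lia); rewrite INR2.
  have -> : \sum_(3 <= i < K) f i = \sum_(2 <= i < K.-1) f i.+1 by rewrite big_add1.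
  have : \sum_(2 <= i < K.-1) f i.+1 <= \sum_(2 <= k < K.-1) (ln (ln (INR k.+1)) - ln (ln (INR k))).
    apply: rsum_le_nat => k /andP[hk _] _; have := INR_ge2 hk.
    by rewrite /f S_INR => h2; apply: lnln_diff_ge; lra.
  have : ln (ln (INR K.-1)) <= ln (ln (INR K)).
    have h2 : 2 <= INR K.-1 by apply: INR_ge2; lia.
    have h3 : INR K.-1 <= INR K by apply: INR_leq; lia.
    by apply: ln_le; [apply: ln_gt0; lra|apply: ln_le; lra].
  lra.
have := Rle_abs (- ln (ln 2)); rewrite Rabs_Ropp; lra.
Qed.

(** Partial summation of the Mertens gap against [1 / ln k], which turns [ln p / p] into [1 / p]. *)
Lemma inv_primes_ge : exists C, 0 < C /\
  forall K, (2 <= K)%N -> ln (ln (INR K)) - C <= inv_primes K.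
Proof.
have hl := ln2_bounds.
pose f k := / ln (INR k).
have hf k : (2 <= k)%N -> 0 <= f k.
  move=> /INR_ge2 h; apply/Rlt_le/Rinv_0_lt_compat.
  by apply: ln_gt0; lra.
have hd k : (2 <= k)%N -> f k.+1 <= f k.
  move=> /INR_ge2 h; apply/Rinv_le_contravar; first by apply: ln_gt0; lra.
  by apply: ln_le; [lra|rewrite S_INR; lra].
have hf2 := hf 2%N isT.
exists (3 * f 2%N + Rabs (ln (ln 2)) + 1); split.
  by have := Rabs_pos (ln (ln 2)); lra.
move=> K hK.
(* The predecessor appears because [lnp_over k] stops at [k - 1]. The gap at 2 equals 3, whence
   [3 f 2] in the constant. *)
have := @abel_ge (fun k => lnp_over k - ln (INR k.-1) + 3) f 2 K ltac:(lia) _ hf hd.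
have hE k : (2 <= k)%N -> 0 <= lnp_over k - ln (INR k.-1) + 3.
  by case: k => // k hk; have := @mertens_ge k ltac:(lia); rewrite /=; lra.
move=> /(_ hE) {hE}.
rewrite [lnp_over 2]rsum_prime_mkcond big_geq // [INR 2.-1]/= ln_1.
have -> : \sum_(2 <= k < K) (lnp_over k.+1 - ln (INR k.+1.-1) + 3 - (lnp_over k - ln (INR k.-1) + 3)) * f k
  = inv_primes K + (-1) * \sum_(2 <= k < K) (ln (INR k) - ln (INR k.-1)) * f k.
  rewrite [inv_primes _]rsum_prime_mkcond.
  rewrite !big_distrr -big_split; apply: eq_big_nat => k /andP[hk _]; rewrite ?S_INR /=.
  have h2 := INR_ge2 hk; have h3 : 0 < ln (INR k) by apply: ln_gt0; lra.
  rewrite [lnp_over k.+1]rsum_prime_recr; last lia.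
  rewrite -/(lnp_over k) /f; case: (prime k); field; lra.
move=> h.
have hs : ln (ln (INR K)) - ln (ln (INR 2)) <= \sum_(2 <= k < K) (ln (INR k) - ln (INR k.-1)) * f k.
  rewrite -(telescope_rsum (fun k => ln (ln (INR k)))) //.
  apply: rsum_le_nat => k /andP[hk _] _; have h2 := INR_ge2 hk.
  have h3 : 0 < ln (INR k) by apply: ln_gt0; lra.
  rewrite S_INR; apply: (Rle_trans _ _ _ (@lnln_diff_le (INR k) ltac:(lra))).
  rewrite Rinv_mult; apply: Rmult_le_compat_r; first by apply: hf.
  have e : INR k = INR k.-1 + 1 by rewrite -S_INR prednK //; lia.
  have := @ln_sub_ge (INR k.-1) (INR k) ltac:(lra) ltac:(lra).
  by have -> : (INR k - INR k.-1) / INR k = / INR k; [rewrite {1}e; field; lra|].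
have := Rle_abs (ln (ln 2)).
rewrite INR2 in hs; lra.
Qed.

(** * Tails of sums weighted by [k^(-s)] *)

Lemma Rpower_gt0 x y : 0 < Rpower x y.
Proof. exact: exp_pos. Qed.

Lemma Rpower_le_neg x y t : 0 < x <= y -> t <= 0 -> Rpower y t <= Rpower x t.
Proof.
move=> hxy ht; have h : ln x <= ln y by apply: ln_le; lra.
rewrite /Rpower; case: (Req_dec (t * ln y) (t * ln x)) => [->|hn]; first lra.
by apply/Rlt_le/exp_increasing; nra.
Qed.

Lemma Rpower_neg_diff t x : 0 < t -> 0 < x ->
  t * Rpower (x + 1) (- t - 1) <= Rpower x (- t) - Rpower (x + 1) (- t).
Proof.
move=> ht hx.
have -> : Rpower x (- t) = Rpower (x + 1) (- t) * exp (t * (ln (x + 1) - ln x)).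
  by rewrite /Rpower -exp_plus; congr exp; ring.
have -> : Rpower (x + 1) (- t - 1) = Rpower (x + 1) (- t) * / (x + 1).
  by rewrite /Rminus Rpower_plus (Rpower_Ropp _ 1) Rpower_1 //; lra.
have h := @ln_sub_ge x (x + 1) hx ltac:(lra).
have h2 := exp_ineq1_le (t * (ln (x + 1) - ln x)).
have e : (x + 1 - x) / (x + 1) = / (x + 1) by field; lra.
have h3 := Rmult_le_compat_l t _ _ ltac:(lra) h; rewrite e in h3.
have h4 := Rpower_gt0 (x + 1) (- t); nra.
Qed.

(** By [Rpower_neg_diff] the terms after the first are dominated by a telescoping sum; the first
    term is bounded separately and gives the 1 in the constant. *)
Lemma Rpower_tail_le s n N : 1 < s -> (0 < n)%N ->
  \sum_(n <= k < N) Rpower (INR k) (- s) <= (1 + / (s - 1)) * Rpower (INR n) (1 - s).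
Proof.
move=> hs hn.
have hi : 0 < / (s - 1) by apply: Rinv_0_lt_compat; lra.
have hn1 : 1 <= INR n by apply: (@INR_leq 1).
have [h|h] := leqP N n.
  by rewrite big_geq //; have := Rpower_gt0 (INR n) (1 - s); nra.
rewrite big_ltn //.
have -> : \sum_(n.+1 <= k < N) Rpower (INR k) (- s) = \sum_(n <= k < N.-1) Rpower (INR k.+1) (- s).
  by rewrite big_add1.
set T := (X in _ + X <= _).
have h1 : T <=
   \sum_(n <= k < N.-1) (/ (s - 1) * (- Rpower (INR k.+1) (1 - s) - - Rpower (INR k) (1 - s))).
  apply: rsum_le_nat => k hk _.
  have hk1 : 0 < INR k by apply: INR_gt0; lia.
  have := @Rpower_neg_diff (s - 1) (INR k) ltac:(lra) hk1.
  rewrite S_INR (_ : - (s - 1) - 1 = - s); last by ring.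
  rewrite (_ : - (s - 1) = 1 - s); last by ring.
  move=> h2; have := Rmult_le_compat_l _ _ _ (Rlt_le _ _ hi) h2.
  rewrite -Rmult_assoc Rinv_l; lra.
rewrite -big_distrr /= (telescope_rsum (fun k => - Rpower (INR k) (1 - s))) in h1; last lia.
have h3 : Rpower (INR n) (- s) <= Rpower (INR n) (1 - s) by apply: Rle_Rpower; lra.
have := Rmult_lt_0_compat _ _ hi (Rpower_gt0 (INR N.-1) (1 - s)); lra.
Qed.

(** Partial summation of [4 k - theta k] against [k^(-s)]. The sum of [4 k^(-s)] and the boundary
    term [4 n * n^(-s)] give the two parts of the constant. The bound is uniform in [N], so no
    infinite series is needed here. *)
Lemma prime_log_tail_le s : 1 < s -> exists C, 0 < C /\ forall y N, 1 <= y ->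
  \sum_(1 <= p < N | prime p && Rle_dec y (INR p)) (ln (INR p) * Rpower (INR p) (- s))
    <= C * Rpower y (1 - s).
Proof.
move=> hs.
have hi : 0 < / (s - 1) by apply: Rinv_0_lt_compat; lra.
exists (4 * (1 + / (s - 1)) + 4); split; first lra.
move=> y N hy.
(* [n] is the ceiling of [y]; replacing [y] by [n] keeps the sum and only shrinks the bound. *)
have [n [hn1 hn2]] : exists n, y <= INR n /\ (forall k, y <= INR k -> (n <= k)%N).
  have [n hn] := nfloor_ex y ltac:(lra).
  case: (Rle_dec y (INR n)) => h; [exists n|exists n.+1]; split => //; try (rewrite S_INR; lra).
    by move=> k hk; apply: leq_INR; lra.
  move=> k hk; rewrite ltnNge; apply/negP => /INR_leq; lra.
have hn0 : (0 < n)%N by case: n hn1 {hn2} => //=; lra.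
apply: (@Rle_trans _ (\sum_(n <= p < N) (if prime p then ln (INR p) * Rpower (INR p) (- s) else 0))).
  have [h|h] := leqP N n.
    rewrite big_nat_cond big_pred0 ?[X in _ <= X]big_geq //; first lra.
    move=> k; apply/negbTE/negP => /andP[h1 /andP[_ /RleP/hn2]]; lia.
  rewrite (big_cat_nat (n := n)) /=; [|lia|lia].
  rewrite big_nat_cond big_pred0 ?Rplus_0_l; last first.
    move=> k; apply/negbTE/negP => /andP[h1 /andP[_ /RleP/hn2]]; lia.
  rewrite -big_mkcond; apply: rsum_subpred => [i _ /andP[]//|i _ hi'].
  by apply: Rmult_le_pos; [exact/Rlt_le/ln_prime_gt0|exact/Rlt_le/Rpower_gt0].
have hle : Rpower (INR n) (1 - s) <= Rpower y (1 - s) by apply: Rpower_le_neg; lra.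
suff : \sum_(n <= p < N) (if prime p then ln (INR p) * Rpower (INR p) (- s) else 0) <=
   (4 * (1 + / (s - 1)) + 4) * Rpower (INR n) (1 - s) by nra.
have [h|h] := leqP N n.
  by rewrite big_geq //; have := Rpower_gt0 (INR n) (1 - s); nra.
pose f k := Rpower (INR k) (- s).
have hE k : (n <= k)%N -> 0 <= 4 * INR k - theta k by have := theta_le k; lra.
have hf k : (n <= k)%N -> 0 <= f k by move=> _; exact/Rlt_le/Rpower_gt0.
have hd k : (n <= k)%N -> f k.+1 <= f k.
  move=> hk; apply: Rpower_le_neg; last lra.
  by split; [apply: INR_gt0; lia|apply: INR_leq].
have := @abel_ge (fun k => 4 * INR k - theta k) f n N (ltnW h) hE hf hd.
have -> : \sum_(n <= k < N) (4 * INR k.+1 - theta k.+1 - (4 * INR k - theta k)) * f k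
  = 4 * \sum_(n <= k < N) f k + (-1) *
     \sum_(n <= p < N) (if prime p then ln (INR p) * Rpower (INR p) (- s) else 0).
  rewrite !big_distrr -big_split; apply: eq_big_nat => k /andP[hk _]; rewrite ?S_INR /=.
  rewrite [theta k.+1]rsum_prime_recr; last lia.
  rewrite -/(theta k) /f; case: (prime k); ring.
have h1 := @Rpower_tail_le s n N hs hn0; rewrite -/f in h1.
have e : INR n * f n = Rpower (INR n) (1 - s).
  by rewrite /Rminus Rpower_plus Rpower_1 //; exact: INR_gt0.
have := theta_ge0 n; have := hf n (leqnn n) => h2 h3.
have : (4 * INR n - theta n) * f n <= 4 * Rpower (INR n) (1 - s) by nra.
rewrite /f in h1 *; lra.
Qed.

(* Mertens' two-sided bound has bounded error, so a fixed ratio [A] forces primes in [(n, A n]]. *)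
Lemma prime_tail_ge s : 1 < s -> exists c A, 0 < c /\ 1 <= A /\ forall y N,
  A <= y -> A * y + 1 <= INR N ->
  c * (Rpower y (1 - s) / ln y) <=
  \sum_(1 <= p < N | prime p && Rle_dec y (INR p)) Rpower (INR p) (- s).
Proof.
move=> hs.
(* 12 = 3 + 8 + 1: the two Mertens errors, and 1 left over for the primes in [(n, A n]]. *)
have [A [hA1 hA2]] : exists A, 2 <= INR A /\ 12 <= ln (INR A).
  have [a ha] := nfloor_ex (exp 12) (Rlt_le _ _ (exp_pos 12)).
  have h12 := exp_ineq1_le 12.
  exists a.+1; rewrite S_INR; split; first lra.
  by rewrite -[X in X <= _]ln_exp; apply: ln_le; [exact: exp_pos|lra].
exists (Rpower (INR A) (1 - s) / 2), (INR A).
have hpA := Rpower_gt0 (INR A) (1 - s).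
split; first lra; split; first lra.
move=> y N hy hN.
have [n hn] := nfloor_ex y ltac:(lra).
have hn0 : (0 < n)%N by apply: leq_INR => /=; case: n hn => [|n] /= hn; [lra|have := pos_INR n.+1; rewrite S_INR; have := pos_INR n; lra].
have hAn : INR (A * n) <= INR A * y by rewrite INR_mul; nra.
have hAn0 : (n <= A * n)%N.
  by rewrite leq_pmull //; apply: leq_INR; rewrite [INR 1]/=; lra.
have hly : 0 < ln y by apply: ln_gt0; lra.
have hlAy : ln (INR A * y) <= 2 * ln y.
  by rewrite ln_mult; [have := @ln_le (INR A) y ltac:(lra) hy; lra|lra|lra].
(* [c0] bounds [p^(1 - s) / ln p] from below for [p <= A y], so [p^(-s) >= c0 * ln p / p] there.
   Since [A <= y], passing from [ln (A y)] to [ln y] costs a factor 2. *)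
set c0 := Rpower (INR A * y) (1 - s) / ln (INR A * y).
have hAy : 0 < ln (INR A * y) by apply: ln_gt0; nra.
have hc0 : 0 < c0 by apply: Rdiv_lt_0_compat => //; exact: Rpower_gt0.
have hc : Rpower (INR A) (1 - s) / 2 * (Rpower y (1 - s) / ln y) <= c0.
  rewrite /c0 -Rpower_mult_distr; [|lra|lra].
  have hpy := Rpower_gt0 y (1 - s).
  have -> : Rpower (INR A) (1 - s) / 2 * (Rpower y (1 - s) / ln y) =
     (Rpower (INR A) (1 - s) * Rpower y (1 - s)) * / (2 * ln y) by field; lra.
  apply: Rmult_le_compat_l; first nra.
  by apply: Rinv_le_contravar.
have h1 : 1 <= \sum_(n.+1 <= p < (A * n).+1 | prime p) (ln (INR p) / INR p).
  have h2 := mertens_le hn0; have h3 := @mertens_ge (A * n) ltac:(lia).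
  rewrite /lnp_over [X in _ <= X](big_cat_nat (n := n.+1)) /= in h3; [|lia|lia].
  rewrite -/(lnp_over n.+1) INR_mul ln_mult in h3; [|lra|exact: INR_gt0].
  lra.
apply: (@Rle_trans _ (c0 * \sum_(n.+1 <= p < (A * n).+1 | prime p) (ln (INR p) / INR p))); first nra.
apply: (@Rle_trans _ (\sum_(n.+1 <= p < (A * n).+1 | prime p) Rpower (INR p) (- s))).
  rewrite big_distrr /=; apply: rsum_le_nat => p /andP[hp1 hp2] pp.
  have h2 := INR_prime_ge2 pp; have h3 := ln_prime_gt0 pp.
  have h4 : INR p <= INR A * y by apply: Rle_trans hAn; apply: INR_leq; lia.
  have h5 : c0 <= Rpower (INR p) (1 - s) / ln (INR p).
    apply: Rmult_le_compat.
    - exact/Rlt_le/Rpower_gt0.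
    - exact/Rlt_le/Rinv_0_lt_compat.
    - by apply: Rpower_le_neg; lra.
    - by apply: Rinv_le_contravar => //; apply: ln_le; lra.
  have -> : Rpower (INR p) (- s) = Rpower (INR p) (1 - s) / ln (INR p) * (ln (INR p) / INR p).
    by rewrite /Rminus Rpower_plus Rpower_1; [field; lra|lra].
  apply: Rmult_le_compat_r => //.
  by apply/Rlt_le/Rdiv_lt_0_compat; lra.
apply: (@Rle_trans _ (\sum_(n.+1 <= p < (A * n).+1 | prime p && Rle_dec y (INR p)) Rpower (INR p) (- s))).
  apply: rsum_subpred => [p /andP[hp _] ->|p _ _]; last exact/Rlt_le/Rpower_gt0.
  by apply/RleP; have := INR_leq hp; rewrite S_INR; lra.
have hN' : ((A * n).+1 <= N)%N by apply: leq_INR; rewrite S_INR; lra.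
apply: (@Rle_trans _ (\sum_(n.+1 <= p < N | prime p && Rle_dec y (INR p)) Rpower (INR p) (- s))).
  by apply: rsum_widen => // p _ _; exact/Rlt_le/Rpower_gt0.
rewrite [X in _ <= X](big_cat_nat (n := n.+1)) /=; [|lia|lia].
set a := (X in _ <= X + _).
have : 0 <= a by apply: rsum_ge0 => p _; exact/Rlt_le/Rpower_gt0.
lra.
Qed.

(** * Double counting of factorisations [k = p m] *)

Lemma bigomega_range n K : (0 < n < K)%N ->
  bigomega n = (\sum_(1 <= p < K | prime p) logn p n)%N.
Proof.
move=> /andP[hn hK].
have -> : bigomega n = (\sum_(1 <= p < K | prime p && (p %| n)) logn p n)%N.
  by apply: big_primesE => // p _ /(dvdn_leq hn) h; exact: leq_ltn_trans h hK.
rewrite big_mkcondr; apply: eq_bigr => p hp.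
case: ifP => // hd; apply/esym/eqP; rewrite -leqn0 leqNgt logn_gt0 mem_primes.
by rewrite hp hd andbF.
Qed.

Lemma bigomega_primeM p m : prime p -> (0 < m)%N -> bigomega (p * m) = (bigomega m).+1.
Proof.
move=> hp hm; have hp0 := prime_gt0 hp.
have hpm : (0 < p * m)%N by rewrite muln_gt0 hp0.
rewrite (@bigomega_range _ (p * m).+1); last by rewrite hpm ltnS leqnn.
rewrite (@bigomega_range m (p * m).+1); last by rewrite hm ltnS leq_pmull.
under eq_bigr => q _ do rewrite lognM // logn_prime //.
rewrite big_split /= -[RHS]add1n; congr addn.
rewrite big_mkcond (bigD1_seq p) //=; last exact: iota_uniq.
  by rewrite hp eqxx big1 // => q /negbTE ->; case: ifP.
by rewrite mem_index_iota hp0 ltnS leq_pmulr.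
Qed.

Lemma logn_le_bigomega p n : (logn p n <= bigomega n)%N.
Proof.
have [h|h] := boolP (p \in primes n); last by rewrite -logn_gt0 -eqn0Ngt in h; rewrite (eqP h).
by rewrite /bigomega (bigD1_seq p) ?primes_uniq //= leq_addr.
Qed.

Lemma prime_dvd_ltn n K p : (0 < n < K)%N -> prime p -> (p %| n)%N -> (p < K)%N.
Proof. by move=> /andP[hn hK] hp hd; apply: leq_ltn_trans hK; apply: dvdn_leq. Qed.

(** There are at most [bigomega k] distinct prime divisors. This bounds how often [k] is met as a
    product [p m]. *)
Lemma rsum_prime_divisors_le k K F : (0 < k < K)%N -> 0 <= F ->
  \sum_(1 <= p < K | prime p && (p %| k)%N) F <= INR (bigomega k) * F.
Proof.
move=> hk hF; have hk0 : (0 < k)%N by case/andP: hk.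
rewrite -(@rsum_primesE k K (fun _ => F)) //; last by move=> p; exact: prime_dvd_ltn.
have : {in primes k, forall p, (0 < logn p k)%N} by move=> p; rewrite logn_gt0.
rewrite /bigomega; elim: (primes k) => [|p r IH] h; first by rewrite !big_nil /=; lra.
rewrite !big_cons INR_add.
have h1 : INR 1 <= INR (logn p k) by apply: INR_leq; apply: h; rewrite mem_head.
have h2 := IH (fun q hq => h q (mem_behead (s := p :: r) hq)).
rewrite [INR 1]/= in h1; nra.
Qed.

Lemma rsum_prime_divisors_ge k K F : (1 < k < K)%N -> 0 <= F ->
  F <= \sum_(1 <= p < K | prime p && (p %| k)%N) F.
Proof.
move=> /andP[hk1 hk2] hF.
rewrite big_mkcond (bigD1_seq (pdiv k)) /=; last exact: iota_uniq.
  rewrite pdiv_prime // pdiv_dvd /=.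
  set a := (X in _ <= _ + X); suff : 0 <= a by lra.
  by apply: rsum_ge0 => p _; case: ifP => _; lra.
by rewrite mem_index_iota pdiv_gt0 (leq_ltn_trans (pdiv_leq (ltnW hk1))).
Qed.

Lemma ln_le_bigomega k K : (0 < k < K)%N ->
  ln (INR k) <= INR (bigomega k) * \sum_(1 <= p < K | prime p && (p %| k)%N) ln (INR p).
Proof.
move=> hk; have hk0 : (0 < k)%N by case/andP: hk.
rewrite ln_primes // (@rsum_primesE _ K) //; last by move=> p; exact: prime_dvd_ltn.
rewrite big_distrr /=; apply: rsum_le => p /andP[hp _].
apply: Rmult_le_compat_r; first exact/Rlt_le/ln_prime_gt0.
exact/INR_leq/logn_le_bigomega.
Qed.

Lemma rsum_dvd_reindex p K (P : pred nat) (f : nat -> R) : (0 < p)%N ->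
  \sum_(1 <= k < K | P k && (p %| k)%N) f k =
  \sum_(1 <= m < K | (p * m < K)%N && P (p * m)%N) f (p * m)%N.
Proof.
move=> hp; rewrite -[LHS]big_filter -[RHS]big_filter.
rewrite -(big_map (muln p) xpredT f); apply: perm_big; apply: uniq_perm.
- exact/filter_uniq/iota_uniq.
- rewrite map_inj_uniq; first exact/filter_uniq/iota_uniq.
  by move=> a b /eqP; rewrite eqn_pmul2l // => /eqP.
move=> k; rewrite mem_filter mem_index_iota; apply/idP/mapP.
  move=> /andP[/andP[hP /dvdnP[m hm]] hk]; exists m; last by rewrite hm mulnC.
  rewrite mem_filter mem_index_iota mulnC -hm hP /=; nia.
move=> [m]; rewrite mem_filter mem_index_iota => /andP[/andP[h1 h2] h3] ->.
rewrite h2 dvdn_mulr //=; nia.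
Qed.

Lemma double_count K (P : pred nat) (H : nat -> nat -> R) :
  \sum_(1 <= k < K | P k) \sum_(1 <= p < K | prime p && (p %| k)%N) H p k =
  \sum_(1 <= p < K | prime p) \sum_(1 <= m < K | (p * m < K)%N && P (p * m)%N) H p (p * m)%N.
Proof.
rewrite (exchange_big_dep prime) /=; last by move=> k p _ /andP[].
apply: eq_bigr => p hp; rewrite -rsum_dvd_reindex ?prime_gt0 //.
by apply: eq_bigl => k; rewrite hp.
Qed.

(** The rectangle [p < N], [m < r] lies below the hyperbola [p m < K], and on a rectangle the sum
    can factor. *)
Lemma double_count_ge K N r (P : pred nat) (H : nat -> nat -> R) :
  (0 < r)%N -> (0 < N)%N -> (N * r <= K)%N -> (forall p k, prime p -> 0 <= H p k) ->
  \sum_(1 <= p < N | prime p) \sum_(1 <= m < r | P (p * m)%N) H p (p * m)%N <=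
  \sum_(1 <= k < K | P k) \sum_(1 <= p < K | prime p && (p %| k)%N) H p k.
Proof.
move=> hr hN hK hH; rewrite double_count.
apply: (@Rle_trans _ (\sum_(1 <= p < N | prime p) \sum_(1 <= m < K | (p * m < K)%N && P (p * m)%N) H p (p * m)%N)).
  apply: rsum_le_nat => p hp1 hp.
  apply: (@Rle_trans _ (\sum_(1 <= m < r | (p * m < K)%N && P (p * m)%N) H p (p * m)%N)).
    apply: rsum_subpred => m hm; last by move=> _; exact: hH.
    by move=> ->; rewrite andbT; nia.
  by apply: rsum_widen => [|m _ _]; [nia|exact: hH].
apply: rsum_widen => [|p _ hp]; first nia.
by apply: rsum_ge0 => m _; exact: hH.
Qed.

(** Dropping [p m < K] enlarges the region to a square. *)
Lemma double_count_le K (P : pred nat) (H : nat -> nat -> R) :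
  (forall p k, prime p -> 0 <= H p k) ->
  \sum_(1 <= k < K | P k) \sum_(1 <= p < K | prime p && (p %| k)%N) H p k <=
  \sum_(1 <= p < K | prime p) \sum_(1 <= m < K | P (p * m)%N) H p (p * m)%N.
Proof.
move=> hH; rewrite double_count; apply: rsum_le => p hp.
by apply: rsum_subpred => m _; [case/andP|move=> _; exact: hH].
Qed.

(** * Reciprocal sums over almost primes *)

Definition inv_ap j K := \sum_(1 <= m < K | (bigomega m <= j)%N) / INR m.

Lemma inv_INR_ge0 k : 0 <= / INR k.
Proof.
case: k => [|k]; first by rewrite Rinv_0; lra.
exact/Rlt_le/Rinv_0_lt_compat/INR_gt0.
Qed.

Lemma rsum_product N r (P Q : pred nat) (f g : nat -> R) :
  \sum_(1 <= p < N | P p) \sum_(1 <= m < r | Q m) (f p * g m) =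
  (\sum_(1 <= p < N | P p) f p) * \sum_(1 <= m < r | Q m) g m.
Proof. by rewrite big_distrl /=; apply: eq_bigr => p _; rewrite big_distrr. Qed.

Lemma bigomega_gt0 k : (1 < k)%N -> (0 < bigomega k)%N.
Proof.
move=> hk; apply: leq_trans (logn_le_bigomega (pdiv k) k).
by rewrite logn_gt0 mem_primes pdiv_prime // pdiv_dvd ltnW.
Qed.

Lemma bigomega1 : bigomega 1 = 0%N.
Proof. by rewrite /bigomega big_nil. Qed.

Lemma inv_ap0 K : (1 < K)%N -> inv_ap 0 K = 1.
Proof.
move=> hK; rewrite /inv_ap big_ltn_cond // bigomega1 /= Rinv_1.
rewrite big_nat_cond big_pred0 ?Rplus_0_r // => k.
by apply/negbTE/negP => /andP[h1]; have := @bigomega_gt0 k ltac:(lia); lia.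
Qed.

(** Each [k > 1] has a prime divisor, so it occurs at least once as [p m]; the summand 1 accounts
    for [k = 1]. *)
Lemma inv_ap_step_le j K : (1 < K)%N -> inv_ap j.+1 K <= 1 + inv_primes K * inv_ap j K.
Proof.
move=> hK; rewrite {1}/inv_ap big_ltn_cond // bigomega1 /= Rinv_1.
apply: Rplus_le_compat_l; rewrite -rsum_product.
apply: (@Rle_trans _ (\sum_(1 <= k < K | (bigomega k <= j.+1)%N) \sum_(1 <= p < K | prime p && (p %| k)%N) / INR k)).
  rewrite [X in _ <= X]big_ltn_cond // bigomega1 /=.
  set a := (X in _ <= X + _).
  have ha : 0 <= a by apply: rsum_ge0 => p _; exact: (inv_INR_ge0 1).
  apply: (@Rle_trans _ (\sum_(2 <= k < K | (bigomega k <= j.+1)%N) \sum_(1 <= p < K | prime p && (p %| k)%N) / INR k)); last lra.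
  by apply: rsum_le_nat => k hk _; apply: rsum_prime_divisors_ge => //; exact: inv_INR_ge0.
apply: (Rle_trans _ _ _ (@double_count_le K _ (fun _ k => / INR k) (fun p k _ => inv_INR_ge0 k))).
apply: rsum_le => p hp.
apply: (@Rle_trans _ (\sum_(1 <= m < K | (bigomega m <= j)%N) / INR (p * m))).
  apply: rsum_subpred => m hm; last by move=> _; exact: inv_INR_ge0.
  by rewrite bigomega_primeM //; lia.
by apply: rsum_le => m _; rewrite INR_mul Rinv_mult; lra.
Qed.

(** Products [p m] with [p, m < r] stay below [K], and each [k] arises from at most [j + 1]
    primes. *)
Lemma inv_ap_step_ge j K r : (0 < r)%N -> (r * r <= K)%N ->
  inv_primes r * inv_ap j r <= INR j.+1 * inv_ap j.+1 K.
Proof.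
move=> hr hK; rewrite -rsum_product.
have h := @double_count_ge K r r (fun k => (bigomega k <= j.+1)%N) (fun p k => / INR k) hr hr hK (fun p k _ => inv_INR_ge0 k).
apply: (@Rle_trans _ (\sum_(1 <= p < r | prime p) \sum_(1 <= m < r | (bigomega (p * m) <= j.+1)%N) / INR (p * m))).
  apply: rsum_le => p hp.
  apply: (@Rle_trans _ (\sum_(1 <= m < r | (bigomega m <= j)%N) / INR (p * m))).
    by apply: rsum_le => m _; rewrite INR_mul Rinv_mult; lra.
  apply: rsum_subpred => m hm; last by move=> _; exact: inv_INR_ge0.
  by rewrite bigomega_primeM //; lia.
apply: (Rle_trans _ _ _ h); rewrite /inv_ap big_distrr /=.
apply: rsum_le_nat => k hk hj.
apply: (Rle_trans _ _ _ (rsum_prime_divisors_le hk (inv_INR_ge0 k))).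
by apply: Rmult_le_compat_r; [exact: inv_INR_ge0|exact: (INR_leq hj)].
Qed.

Lemma lnln_ge B x : exp (exp B) <= x -> B <= ln (ln x).
Proof.
move=> h; have h1 := exp_pos B; have h2 := exp_pos (exp B).
have h3 : exp B <= ln x by rewrite -[X in X <= _]ln_exp; apply: ln_le.
by rewrite -[X in X <= _]ln_exp; apply: ln_le.
Qed.

Lemma lnln_le x y : 1 < x -> x <= y -> ln (ln x) <= ln (ln y).
Proof. by move=> h1 h2; apply: ln_le; [exact: ln_gt0|apply: ln_le; lra]. Qed.

(** [r] is the integer part of [sqrt x]. Restricting variables to [r] loses only a constant factor
    in [ln ln]. *)
Lemma sqrt_floor R0 : exists X0, 1 < X0 /\ forall x, X0 <= x -> exists r : nat,
  [/\ INR r * INR r <= x, R0 <= INR r, (2 <= r)%N & ln (ln x) / 2 <= ln (ln (INR r))].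
Proof.
pose R1 := Rmax R0 3.
have hR0 : R0 <= R1 by exact: Rmax_l.
have hR1 : 3 <= R1 by exact: Rmax_r.
exists (exp 9 + (R1 + 1) * (R1 + 1)); have he := exp_pos 9.
split; first nra.
move=> x hx; have hx0 : 0 <= x by nra.
have [r [hr1 hr2]] := nfloor_ex _ (sqrt_pos x).
have hs := sqrt_sqrt x hx0; have hs0 := sqrt_pos x.
have h1 : R1 + 1 <= sqrt x.
  rewrite -(sqrt_square (R1 + 1)); last lra.
  by apply: sqrt_le_1_alt; lra.
have hr3 : 3 <= INR r by lra.
exists r; split; [nra|lra|by apply: leq_INR; rewrite INR2; lra|].
(* [x < (r + 1)^2 <= r^3] for [r >= 3], so [ln x <= 3 ln r]; the resulting [ln 3] is at most half of
   [ln (ln x)] once [ln x >= 9]. *)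
have hx3 : x <= INR r * (INR r * INR r) by nra.
have hlr : 0 < ln (INR r) by apply: ln_gt0; lra.
have hl9 : 9 <= ln x.
  by rewrite -[X in X <= _]ln_exp; apply: ln_le => //; nra.
have hl3 : ln x <= 3 * ln (INR r).
  have : ln x <= ln (INR r * (INR r * INR r)) by apply: ln_le => //; nra.
  by rewrite !ln_mult; try nra.
have h9 : 2 * ln 3 <= ln (ln x).
  have -> : 2 * ln 3 = ln (3 * 3) by rewrite ln_mult; lra.
  by apply: ln_le; lra.
have : ln (ln x) <= ln (3 * ln (INR r)) by apply: ln_le; lra.
by rewrite ln_mult; lra.
Qed.

Lemma inv_ap_le j : exists C, 0 < C /\ forall K, (3 <= K)%N -> 1 <= ln (ln (INR K)) ->
  inv_ap j K <= C * ln (ln (INR K)) ^ j.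
Proof.
have [C [hC hS]] := inv_primes_le.
elim: j => [|j [D [hD IH]]].
  by exists 1; split; [lra|move=> K hK _; rewrite inv_ap0 /=; [lra|lia]].
exists (1 + (4 + C) * D); split; first nra.
move=> K hK hL; apply: (Rle_trans _ _ _ (@inv_ap_step_le j K ltac:(lia))).
have h1 := hS K hK; have h2 := IH K hK hL.
set L := ln (ln (INR K)) in hL h1 h2 *.
have hLj : 1 <= L ^ j by apply: pow_R1_Rle.
have h3 : inv_primes K <= (4 + C) * L by nra.
have h4 : inv_primes K * inv_ap j K <= (4 + C) * L * (D * L ^ j).
  apply: Rmult_le_compat => //; first by apply: rsum_ge0 => p _; exact: inv_INR_ge0.
  by apply: rsum_ge0 => p _; exact: inv_INR_ge0.
have h5 : 1 <= L * L ^ j by nra.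
rewrite /=; nra.
Qed.

(** Induction through [inv_ap_step_ge] at [r = floor (sqrt K)]. Positivity of [ln ln] is carried
    along so that later powers can be compared. *)
Lemma inv_ap_ge j : exists c X0, 0 < c /\ 1 < X0 /\ forall K, X0 <= INR K ->
  0 < ln (ln (INR K)) /\ c * ln (ln (INR K)) ^ j <= inv_ap j K.
Proof.
have [C [hC hS]] := inv_primes_ge.
have ee B : 1 < exp (exp B).
  by have := exp_pos B; have := exp_ineq1_le (exp B); lra.
elim: j => [|j [c [X0 [hc [hX0 IH]]]]].
  exists 1, (exp (exp 1)); split; first lra; split; first exact: ee.
  move=> K hK; have h1 := lnln_ge hK; have := ee 1 => h2; split; first lra.
  by rewrite inv_ap0 /=; [lra|apply: leq_INR; rewrite INR2; have := exp_ineq1_le 1;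
     have := exp_ineq1_le (exp 1); lra].
(* The threshold forces [ln (ln r) >= 2 C], so that [inv_primes r] is at least half of
   [ln (ln r)]. *)
have [X1 [hX1 hq]] := sqrt_floor (Rmax X0 (exp (exp (2 * C)))).
have hm1 := Rmax_l X0 (exp (exp (2 * C))).
have hm2 := Rmax_r X0 (exp (exp (2 * C))).
exists (c / 2 * / 2 ^ j.+1 * / INR j.+1), (X1 + exp (exp 1)).
have hj : 0 < INR j.+1 by exact: INR_gt0.
have hj2 : 0 < 2 ^ j.+1 by apply: pow_lt; lra.
have hcc : 0 < c / 2 * / 2 ^ j.+1.
  by apply: Rmult_lt_0_compat; [lra|exact: Rinv_0_lt_compat].
split; first by apply: Rmult_lt_0_compat => //; exact: Rinv_0_lt_compat.
have h1 := exp_pos (exp 1); split; first lra.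
move=> K hK.
have [r [hr1 hr2 hr3 hr4]] := hq (INR K) ltac:(lra).
have hL : 1 <= ln (ln (INR K)) by apply: lnln_ge; lra.
split; first lra.
have [hLr hQ] := IH r ltac:(lra).
have hS1 := hS r hr3.
have hCr : 2 * C <= ln (ln (INR r)) by apply: lnln_ge; lra.
have hst := @inv_ap_step_ge j K r ltac:(lia).
have hrK : (r * r <= K)%N by apply: leq_INR; rewrite INR_mul.
have {}hst := hst hrK.
set L := ln (ln (INR K)) in hL hr4 *; set Lr := ln (ln (INR r)) in hr4 hLr hQ hS1 hCr.
have h2 : (L / 2) ^ j.+1 <= Lr ^ j.+1 by apply: pow_incr; lra.
have h3 : (Lr / 2) * (c * Lr ^ j) <= inv_primes r * inv_ap j r.
  apply: Rmult_le_compat => //; try lra.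
  by apply: Rmult_le_pos; [lra|apply: pow_le; lra].
have e : (L / 2) ^ j.+1 = L ^ j.+1 * / 2 ^ j.+1.
  by rewrite /Rdiv Rpow_mult_distr pow_inv.
rewrite e in h2.
have h4 : c / 2 * (L ^ j.+1 * / 2 ^ j.+1) <= c / 2 * Lr ^ j.+1 by apply: Rmult_le_compat_l; lra.
have h5 : c / 2 * Lr ^ j.+1 = Lr / 2 * (c * Lr ^ j) by rewrite -tech_pow_Rmult; field.
have h6 : c / 2 * / 2 ^ j.+1 * / INR j.+1 * L ^ j.+1 = (c / 2 * (L ^ j.+1 * / 2 ^ j.+1)) / INR j.+1.
  by rewrite /Rdiv; ring.
rewrite h6; apply/Rle_div_l => //; lra.
Qed.

(** * Tail sums over almost primes *)

Definition ap_tail l s M N :=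
  \sum_(1 <= k < N | almost_prime l k && Rle_dec M (INR k)) Rpower (INR k) (- s).

Lemma almost_primeM l p m : prime p -> (0 < m)%N ->
  almost_prime l.+1 (p * m) = (bigomega m <= l)%N.
Proof.
by move=> hp hm; rewrite /almost_prime bigomega_primeM // muln_gt0 prime_gt0 // hm.
Qed.

Lemma RpowerM_INR p m t : (0 < p)%N -> (0 < m)%N ->
  Rpower (INR (p * m)) t = Rpower (INR p) t * Rpower (INR m) t.
Proof. by move=> hp hm; rewrite INR_mul Rpower_mult_distr //; exact: INR_gt0. Qed.

(** Source of the weight [1 / m], and hence of [inv_ap], in both tail estimates. *)
Lemma Rpower_quot_scale s M m : 0 < M -> 0 < m ->
  Rpower m (- s) * Rpower (M / m) (1 - s) = Rpower M (1 - s) * / m.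
Proof.
move=> hM hm; rewrite /Rpower ln_div // -{3}(exp_ln m hm) -exp_Ropp -!exp_plus.
by congr exp; ring.
Qed.

Lemma ap_tail_ge l s : 1 < s -> exists c X0, 0 < c /\ 1 < X0 /\ forall M, X0 <= M ->
  exists N, c * (ln (ln M) ^ l * (Rpower M (1 - s) / ln M)) <= ap_tail l.+1 s M N.
Proof.
move=> hs; have [c [A [hc [hA hL1]]]] := prime_tail_ge hs.
have [d [X1 [hd [hX1 hQ]]]] := inv_ap_ge l.
have [X0 [hX0 hq]] := sqrt_floor (Rmax A X1).
have hm1 := Rmax_l A X1; have hm2 := Rmax_r A X1.
have hl : 0 < INR l.+1 by exact: INR_gt0.
have h2l : 0 < 2 ^ l by apply: pow_lt; lra.
exists (c * d * / 2 ^ l / INR l.+1), (X0 + exp (exp 1)); split.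
  apply: Rdiv_lt_0_compat => //; apply: Rmult_lt_0_compat; first nra.
  exact: Rinv_0_lt_compat.
have he := exp_pos (exp 1); split; first lra.
move=> M hM.
have hLM : 1 <= ln (ln M) by apply: lnln_ge; lra.
have [r [hr1 hr2 hr3 hr4]] := hq M ltac:(lra).
have [hLr hQr] := hQ r ltac:(lra).
have hlM : 0 < ln M by apply: ln_gt0; lra.
(* [N0 >= A M + 1] is large enough for [prime_tail_ge] at every [y = M / m] simultaneously. *)
have [n0 [_ hn0]] := nfloor_ex (A * M + 1) ltac:(nra).
pose N0 := n0.+1.
have hN0 : A * M + 1 <= INR N0 by rewrite S_INR; lra.
exists (N0 * r)%N.
have hr0 : (0 < r)%N by lia.
have hpos k : 0 <= Rpower (INR k) (- s) by exact/Rlt_le/Rpower_gt0.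
have h := @double_count_ge (N0 * r) N0 r (fun k => almost_prime l.+1 k && Rle_dec M (INR k))
  (fun p k => Rpower (INR k) (- s)) hr0 (ltn0Sn _) (leqnn _) (fun p k _ => hpos k).
have hT : \sum_(1 <= k < N0 * r | almost_prime l.+1 k && Rle_dec M (INR k))
   \sum_(1 <= p < N0 * r | prime p && (p %| k)%N) Rpower (INR k) (- s) <= INR l.+1 * ap_tail l.+1 s M (N0 * r).
  rewrite /ap_tail big_distrr /=; apply: rsum_le_nat => k hk /andP[/andP[_ hap] _].
  apply: (Rle_trans _ _ _ (rsum_prime_divisors_le hk (hpos k))).
  by apply: Rmult_le_compat_r; [exact: hpos|exact: (INR_leq hap)].
suff h3 : c * (Rpower M (1 - s) / ln M) * inv_ap l r <=
  \sum_(1 <= p < N0 | prime p)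
       \sum_(1 <= m < r | almost_prime l.+1 (p * m) && Rle_dec M (INR (p * m)))
          Rpower (INR (p * m)) (- s).
  have h4 : (ln (ln M) / 2) ^ l <= ln (ln (INR r)) ^ l by apply: pow_incr; lra.
  rewrite /Rdiv Rpow_mult_distr pow_inv in h4.
  set Z := Rpower M (1 - s) / ln M in h3 *.
  have hZ : 0 < Z by apply: Rdiv_lt_0_compat => //; exact: Rpower_gt0.
  have hcZ : 0 < c * Z by nra.
  have -> : c * d * / 2 ^ l / INR l.+1 * (ln (ln M) ^ l * Z) =
     (c * Z * (d * (ln (ln M) ^ l * / 2 ^ l))) / INR l.+1 by field; lra.
  apply/Rle_div_l => //.
  have h5 : d * (ln (ln M) ^ l * / 2 ^ l) <= inv_ap l r by nra.
  have := Rmult_le_compat_l _ _ _ (Rlt_le _ _ hcZ) h5; lra.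
apply: (@Rle_trans _ (\sum_(1 <= m < r | (bigomega m <= l)%N)
   (Rpower (INR m) (- s) * \sum_(1 <= p < N0 | prime p && Rle_dec (M / INR m) (INR p)) Rpower (INR p) (- s)))).
  rewrite /inv_ap big_distrr /=; apply: rsum_le_nat => m /andP[hm1' hm2'] _.
  have hm0 : 1 <= INR m by apply: (@INR_leq 1).
  have hmr := INR_ltn hm2'.
  (* From [m < r] and [r^2 <= M]; since [A <= r], the prime tail bound applies at [M / m]. *)
  have hy : INR r <= M / INR m by apply/Rle_div_r; [lra|nra].
  have hyM : M / INR m <= M by apply/Rle_div_l; [lra|nra].
  have hy2 := INR_ge2 hr3.
  have h3 := hL1 (M / INR m) N0 ltac:(lra) ltac:(nra).
  have hp := Rpower_gt0 (INR m) (- s).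
  apply: (Rle_trans _ (Rpower (INR m) (- s) * (c * (Rpower (M / INR m) (1 - s) / ln (M / INR m))))); last first.
    by apply: Rmult_le_compat_l => //; lra.
  have hly : 0 < ln (M / INR m) by apply: ln_gt0; lra.
  have -> : Rpower (INR m) (- s) * (c * (Rpower (M / INR m) (1 - s) / ln (M / INR m))) =
    c * (Rpower (INR m) (- s) * Rpower (M / INR m) (1 - s)) * / ln (M / INR m) by rewrite /Rdiv; ring.
  rewrite Rpower_quot_scale; [|lra|lra].
  have -> : c * (Rpower M (1 - s) / ln M) * / INR m = c * (Rpower M (1 - s) * / INR m) * / ln M.
    by rewrite /Rdiv; ring.
  apply: Rmult_le_compat_l.
    apply: Rmult_le_pos; first lra.
    by apply: Rmult_le_pos; [exact/Rlt_le/Rpower_gt0|exact: inv_INR_ge0].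
  by apply: Rinv_le_contravar => //; apply: ln_le; lra.
right; symmetry.
rewrite big_nat_cond (eq_bigr (fun p => \sum_(1 <= m < r | (bigomega m <= l)%N && Rle_dec (M / INR m) (INR p))
   (Rpower (INR m) (- s) * Rpower (INR p) (- s)))); last first.
  move=> p /andP[hp1 hp].
  rewrite big_nat_cond [RHS]big_nat_cond; apply: eq_big => m.
    case: (boolP (1 <= m < r)%N) => //= hm; rewrite almost_primeM //; last by case/andP: hm.
    congr andb; have hm0 : 0 < INR m by apply: INR_gt0; case/andP: hm.
    rewrite INR_mul; apply/RleP/RleP => h3; first by apply/Rle_div_l.
    by apply/Rle_div_l.
  by move=> /andP[/andP[hm _] _]; rewrite RpowerM_INR ?(prime_gt0 hp) // Rmult_comm.
rewrite -big_nat_cond (exchange_big_dep (fun m => (bigomega m <= l)%N)) /=; last by move=> p m _ /andP[].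
apply: eq_bigr => m hm; rewrite big_distrr /=; apply: eq_bigl => p.
by rewrite hm.
Qed.

Lemma ap_tail_le l s : 1 < s -> exists C X0, 0 < C /\ 1 < X0 /\ forall M N, X0 <= M ->
  ap_tail l.+1 s M N <= C * (ln (ln M) ^ l * (Rpower M (1 - s) / ln M)).
Proof.
move=> hs; have [C [hC hU1]] := prime_log_tail_le hs.
have [D [hD hQ]] := inv_ap_le l.
have hi : 0 < / (s - 1) by apply: Rinv_0_lt_compat; lra.
pose q := INR l.+1; have hl : 0 < q by exact: INR_gt0.
have h2l : 0 < 2 ^ l by apply: pow_lt; lra.
have he1 := exp_ineq1_le 1; have he2 := exp_ineq1_le (exp 1).
exists (q * C * (D * 2 ^ l + (1 + / (s - 1)))), (exp (exp 1)); split.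
  by apply: Rmult_lt_0_compat; nra.
split; first lra.
move=> M N hM.
have hLM : 1 <= ln (ln M) by apply: lnln_ge.
have hlM : 0 < ln M by apply: ln_gt0; lra.
have [n [hn1 hn2]] := nfloor_ex M ltac:(lra).
have hMS : M < INR n.+1 by rewrite S_INR.
set Z := Rpower M (1 - s); have hZ : 0 < Z by exact: Rpower_gt0.
(* Every [k] in the sum satisfies [ln M <= ln k], and [ln k] is at most [q] times the sum of [ln p]
   over the primes dividing [k]. *)
suff H : ln M * ap_tail l.+1 s M N <= q * C * (D * 2 ^ l + (1 + / (s - 1))) * (ln (ln M) ^ l * Z).
  rewrite /Rdiv -!Rmult_assoc; apply/(Rle_div_r _ _ (ln M)) => //.
  by rewrite Rmult_comm; lra.
have hpos p k : prime p -> 0 <= q * (ln (INR p) * Rpower (INR k) (- s)).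
  move=> hp; apply: Rmult_le_pos; first lra.
  by apply: Rmult_le_pos; [exact/Rlt_le/ln_prime_gt0|exact/Rlt_le/Rpower_gt0].
apply: (@Rle_trans _ (\sum_(1 <= k < N | almost_prime l.+1 k && Rle_dec M (INR k))
   \sum_(1 <= p < N | prime p && (p %| k)%N) (q * (ln (INR p) * Rpower (INR k) (- s))))).
  rewrite /ap_tail big_distrr /=; apply: rsum_le_nat => k hk /andP[/andP[_ hap] /RleP hMk].
  rewrite -big_distrr -big_distrl /= -Rmult_assoc.
  apply: Rmult_le_compat_r; first exact/Rlt_le/Rpower_gt0.
  apply: (@Rle_trans _ (ln (INR k))); first by apply: ln_le; lra.
  apply: (Rle_trans _ _ _ (ln_le_bigomega hk)); apply: Rmult_le_compat_r.
    by apply: rsum_ge0 => p /andP[hp _]; exact/Rlt_le/ln_prime_gt0.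
  exact: (INR_leq hap).
apply: (Rle_trans _ _ _ (@double_count_le N _ (fun p k => q * (ln (INR p) * Rpower (INR k) (- s))) hpos)).
(* The maximum with 1 changes nothing for primes but meets the hypothesis [1 <= y] of
   [prime_log_tail_le] when [m > M]. *)
apply: (@Rle_trans _ (\sum_(1 <= m < N | (bigomega m <= l)%N)
   (q * (Rpower (INR m) (- s) * \sum_(1 <= p < N | prime p && Rle_dec (Rmax 1 (M / INR m)) (INR p))
     (ln (INR p) * Rpower (INR p) (- s)))))).
  right.
  rewrite big_nat_cond (eq_bigr (fun p => \sum_(1 <= m < N | (bigomega m <= l)%N && Rle_dec (Rmax 1 (M / INR m)) (INR p))
   (q * (Rpower (INR m) (- s) * (ln (INR p) * Rpower (INR p) (- s)))))); last first.
    move=> p /andP[hp1 hp].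
    rewrite big_nat_cond [RHS]big_nat_cond; apply: eq_big => m.
      case: (boolP (1 <= m < N)%N) => //= hm; rewrite almost_primeM //; last by case/andP: hm.
      congr andb; have hm0 : 0 < INR m by apply: INR_gt0; case/andP: hm.
      have hp2 := INR_prime_ge2 hp.
      rewrite INR_mul; apply/RleP/RleP => h3.
        by apply: Rmax_lub; [lra|apply/Rle_div_l].
      by apply/Rle_div_l => //; apply: Rle_trans h3; exact: Rmax_r.
    move=> /andP[/andP[hm _] _]; rewrite RpowerM_INR ?(prime_gt0 hp) //; ring.
  rewrite -big_nat_cond (exchange_big_dep (fun m => (bigomega m <= l)%N)) /=; last by move=> p m _ /andP[].
  apply: eq_bigr => m hm; rewrite !big_distrr /=; apply: eq_bigl => p.
  by rewrite hm.
(* With [n = floor M]: for [m <= n] the bound scales to [Z / m]; for [m > n] the prime sum is at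
   most [C], leaving [m^(-s)]. *)
apply: (@Rle_trans _ (q * C * \sum_(1 <= m < N | (bigomega m <= l)%N)
   (Z * (if (m < n.+1)%N then / INR m else 0) + (if (n.+1 <= m)%N then Rpower (INR m) (- s) else 0)))).
  rewrite big_distrr /=; apply: rsum_le_nat => m /andP[hm _] _.
  rewrite [X in _ <= X]Rmult_assoc; apply: Rmult_le_compat_l; first lra.
  have hm0 : 1 <= INR m by apply: (@INR_leq 1).
  have hmax := Rmax_l 1 (M / INR m).
  apply: (@Rle_trans _ (Rpower (INR m) (- s) * (C * Rpower (Rmax 1 (M / INR m)) (1 - s)))).
    by apply: Rmult_le_compat_l; [exact/Rlt_le/Rpower_gt0|exact: hU1].
  rewrite -Rmult_assoc (Rmult_comm _ C) Rmult_assoc; apply: Rmult_le_compat_l; first lra.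
  rewrite ltnS; case: leqP => hmn.
    have hmM : INR m <= M by have := INR_leq hmn; lra.
    rewrite Rmax_right; last by apply/Rle_div_r; lra.
    by rewrite Rpower_quot_scale /Z; lra.
  have hmM : M < INR m by have := INR_leq hmn; lra.
  rewrite Rmax_left; last by apply/Rle_div_l; lra.
  by rewrite {2}/Rpower ln_1 Rmult_0_r exp_0; lra.
rewrite [X in _ <= X]Rmult_assoc; apply: Rmult_le_compat_l; first nra.
rewrite big_split /= -big_distrr /= -!big_mkcondr /=.
have h1 : \sum_(1 <= m < N | (bigomega m <= l)%N && (m < n.+1)%N) / INR m <= inv_ap l n.+1.
  rewrite /inv_ap (@big_nat_widen _ _ _ 1 n.+1 (maxn N n.+1)); last by rewrite leq_maxr.
  by apply: rsum_widen => [|m _ _]; [rewrite leq_maxl|exact: inv_INR_ge0].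
have h2 : \sum_(1 <= m < N | (bigomega m <= l)%N && (n < m)%N) Rpower (INR m) (- s) <=
   (1 + / (s - 1)) * Z.
  apply: (@Rle_trans _ (\sum_(n.+1 <= m < N) Rpower (INR m) (- s))).
    rewrite (@big_nat_widenl _ _ _ n.+1 1) //.
    apply: rsum_subpred => [m _ /andP[_ ->] //|m _ _]; exact/Rlt_le/Rpower_gt0.
  apply: (Rle_trans _ _ _ (@Rpower_tail_le s n.+1 N hs isT)).
  by apply: Rmult_le_compat_l; [lra|apply: Rpower_le_neg; lra].
have hn3 : (3 <= n.+1)%N by apply: leq_INR; rewrite S_INR [INR 2]/=; lra.
have hLn : ln (ln M) <= ln (ln (INR n.+1)) by apply: lnln_le; lra.
(* [n + 1 <= M^2], and squaring adds only [ln 2 < 1 <= ln (ln M)]. *)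
have hLn2 : ln (ln (INR n.+1)) <= 2 * ln (ln M).
  have h3 : ln (ln (INR n.+1)) <= ln (ln (M * M)) by apply: lnln_le; [lra|rewrite S_INR; nra].
  have h4 : ln (ln (M * M)) = ln 2 + ln (ln M).
    have -> : ln (M * M) = 2 * ln M by rewrite ln_mult; lra.
    by rewrite ln_mult; lra.
  have := ln2_bounds; lra.
have h3 := hQ n.+1 hn3 ltac:(lra).
have h4 : ln (ln (INR n.+1)) ^ l <= 2 ^ l * ln (ln M) ^ l.
  by rewrite -Rpow_mult_distr; apply: pow_incr; lra.
have h5 : 1 <= ln (ln M) ^ l by apply: pow_R1_Rle.
have h6 : inv_ap l n.+1 <= D * (2 ^ l * ln (ln M) ^ l) by nra.
have h7 : Z * inv_ap l n.+1 <= Z * (D * (2 ^ l * ln (ln M) ^ l)) by apply: Rmult_le_compat_l; lra.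
have h8 : (1 + / (s - 1)) * Z <= (1 + / (s - 1)) * (ln (ln M) ^ l * Z).
  by apply: Rmult_le_compat_l; [lra|nra].
have h9 := Rmult_le_compat_l _ _ _ (Rlt_le _ _ hZ) h1.
lra.
Qed.

(** [sum_n] includes both ends; the term at 0 vanishes because [almost_prime] excludes 0. *)
Lemma sum_n_P_term l s M N : sum_n (P_term l s M) N = ap_tail l s M N.+1.
Proof.
rewrite /ap_tail big_mkcond /=; elim: N => [|N IH]; first by rewrite sum_O big_geq.
rewrite sum_Sn IH [RHS]big_nat_recr //=; congr Rplus.
by rewrite /P_term Rpower_Ropp.
Qed.

(** [Series] is a total function, so convergence must be proved before its value means anything; it
    follows from monotone bounded partial sums. *)
Lemma Series_ge0_bounds (a : nat -> R) B : (forall n, 0 <= a n) ->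
  (forall n, sum_n a n <= B) -> Series a <= B /\ forall n, sum_n a n <= Series a.
Proof.
move=> ha hB.
have hincr n : sum_n a n <= sum_n a n.+1.
  by rewrite sum_Sn; have := ha n.+1; rewrite /plus /=; lra.
have hs : is_lim_seq (sum_n a) (Series a).
  by apply: Series_correct; exact: (ex_finite_lim_seq_incr _ _ hincr hB).
split; first exact: (is_lim_seq_le _ _ _ _ hB hs (is_lim_seq_const B)).
exact: is_lim_seq_incr_compare hs hincr.
Qed.

Lemma P_sum_bounds l s : 1 < s -> exists C1 C2 M0 : R, 0 < C1 /\ 0 < C2 /\
  forall M : R, M0 <= M ->
    C1 * (ln (ln M) ^ l * (Rpower M (1 - s) / ln M)) <= P_sum l.+1 s M /\
    P_sum l.+1 s M <= C2 * (ln (ln M) ^ l * (Rpower M (1 - s) / ln M)).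
Proof.
move=> hs; have [c [X0 [hc [hX0 hlo]]]] := ap_tail_ge l hs.
have [C [X1 [hC [hX1 hup]]]] := ap_tail_le l hs.
exists c, C, (X0 + X1); split => //; split => // M hM.
have [N hN] := hlo M ltac:(lra).
have hterm n : 0 <= P_term l.+1 s M n.
  rewrite /P_term -Rpower_Ropp; case: ifP => _; last lra.
  exact/Rlt_le/Rpower_gt0.
have [|h1 h2] := Series_ge0_bounds hterm (B := C * (ln (ln M) ^ l * (Rpower M (1 - s) / ln M))).
  by move=> n; rewrite sum_n_P_term; apply: hup; lra.
(* A single partial sum gives the lower bound, after widening its range from [N] to [N.+1]. *)
split => //; apply: Rle_trans (h2 N); rewrite sum_n_P_term; apply: Rle_trans hN _.
by apply: rsum_widen => // k _ _; exact/Rlt_le/Rpower_gt0.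
Qed.

End AlmostPrimes.

Theorem theorem1p7 (l : nat) (s : R) :
  (1 <= l)%nat -> 1 < s ->
  exists C1 C2 M0 : R, 0 < C1 /\ 0 < C2 /\
    forall M : R, 1 <= M -> M0 <= M ->
      C1 * ((ln (ln M)) ^ (l - 1) / (Rpower M (s - 1) * ln M)) <= P_sum l s M /\
      P_sum l s M <= C2 * ((ln (ln M)) ^ (l - 1) / (Rpower M (s - 1) * ln M)).
Proof.
  destruct l as [|l]; [lia|]; intros _ hs.
  destruct (AlmostPrimes.P_sum_bounds l hs) as (C1 & C2 & M0 & h1 & h2 & h).
  exists C1, C2, M0; repeat split; try easy; intros;
    replace (ln (ln M) ^ (S l - 1) / (Rpower M (s - 1) * ln M))
      with (ln (ln M) ^ l * (Rpower M (1 - s) / ln M)).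
  all: try now apply h.
  all: replace (1 - s) with (- (s - 1)) by ring; rewrite Rpower_Ropp, Nat.sub_succ, Nat.sub_0_r;
    unfold Rdiv; rewrite Rinv_mult; reflexivity.
Qed.
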